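(* Let $\Omega\subseteq\mathbb{R}^2$ be a domain, let $u\in\mathcal{C}^\infty(\Omega)$ with $|Du|<1$ on $\Omega$, and let $\Sigma_u=\{(x,y,u(x,y)):(x,y)\in\Omega\}$ be the corresponding spacelike graph in $\mathbb{L}^3$. If $H_R=H_L$ on $\Sigma_u$, then $$\mathrm{inradius}(\Omega)\leq \frac{1}{2\sqrt{2}\,\inf_{\Sigma_u}|H_R|}.$$
   Context: A domain is a nonempty connected open set. The inradius of a set in $\mathbb{R}^2$ is the supremum (possibly $+\infty$) of the radii of the closed discs contained in it. The right-hand side of the inequality is understood as $+\infty$ when $\inf|H_R|=0$. $D$, $|\cdot|$ and $\mathrm{div}$ denote the gradient, norm and divergence in the Euclidean plane $\mathbb{R}^2$. $\mathbb{L}^3$ is $\mathbb{R}^3$ with the Lorentzian metric $dx^2+dy^2-dz^2$; the graph $\Sigma_u$ is spacelike (its induced metric from $\mathbb{L}^3$ is Riemannian) if and only if $|Du|<1$. The mean curvature functions of $\Sigma_u$ in $\mathbb{R}^3$ (with respect to the upward unit normal) and in $\mathbb{L}^3$ (with respect to the future-directed unit normal) are, at the point $(x,y,u(x,y))$, $$H_R=\tfrac12\,\mathrm{div}\left(\frac{Du}{\sqrt{1+|Du|^2}}\right)(x,y),\qquad H_L=\tfrac12\,\mathrm{div}\left(\frac{Du}{\sqrt{1-|Du|^2}}\right)(x,y).$$ *)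

(* Defs.v *)
From HB Require Import structures.
From mathcomp Require Import all_boot all_order all_algebra.
From mathcomp Require Import all_classical all_reals all_analysis.

Set Implicit Arguments.
Unset Strict Implicit.
Unset Printing Implicit Defensive.

Import Order.TTheory GRing.Theory Num.Theory.
Import numFieldNormedType.Exports.

Local Open Scope classical_set_scope.
Local Open Scope ring_scope.

Definition domain (R : realType) (Omega : set (R * R)) : Prop :=
  [/\ Omega !=set0, open Omega & connected Omega].

(* The library norm on [R * R] is the sup norm (it induces the same topology),
   so the Euclidean norm has to be defined separately. *)
Definition enorm (R : realType) (v : R * R) : R :=
  Num.sqrt (v.1 ^+ 2 + v.2 ^+ 2).

Definition closed_disc (R : realType) (c : R * R) (r : R) : set (R * R) :=
  [set q | enorm (q - c) <= r].

Definition inradius (R : realType) (A : set (R * R)) : \bar R :=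
  ereal_sup [set r%:E | r in
    [set r : R | 0 < r /\ exists c : R * R, closed_disc c r `<=` A]].

Definition e1 (R : realType) : R * R := (1, 0).
Definition e2 (R : realType) : R * R := (0, 1).

(* Functions on an open set Omega are represented by total functions; only
   their germs at points of Omega matter below. *)
Fixpoint Cn_on (R : realType) (n : nat) (Omega : set (R * R))
    (f : R * R -> R) : Prop :=
  (forall p, Omega p -> {for p, continuous f}) /\
  (if n is m.+1 then
     [/\ forall p, Omega p -> derivable f p (e1 R),
         forall p, Omega p -> derivable f p (e2 R),
         Cn_on m Omega ('D_(e1 R) f) & Cn_on m Omega ('D_(e2 R) f)]
   else True).

Definition smooth_on (R : realType) (Omega : set (R * R))
    (f : R * R -> R) : Prop :=
  forall n : nat, Cn_on n Omega f.

Definition grad (R : realType) (u : R * R -> R) (p : R * R) : R * R :=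
  ('D_(e1 R) u p, 'D_(e2 R) u p).

Definition div (R : realType) (F : R * R -> R * R) (p : R * R) : R :=
  'D_(e1 R) (fun q => (F q).1) p + 'D_(e2 R) (fun q => (F q).2) p.

Definition graph_of (R : realType) (Omega : set (R * R)) (u : R * R -> R) :
    set (R * R * R) :=
  [set (p, u p) | p in Omega].

(* Mean curvatures of the graph of u at its point P = ((x, y), u (x, y)), for
   the upward normal in Euclidean 3-space and the future-directed normal in
   Lorentz-Minkowski 3-space (metric dx^2 + dy^2 - dz^2) respectively. *)
Definition HR (R : realType) (u : R * R -> R) (P : R * R * R) : R :=
  2^-1 * div (fun q => (Num.sqrt (1 + enorm (grad u q) ^+ 2))^-1 *: grad u q)
             P.1.

Definition HL (R : realType) (u : R * R -> R) (P : R * R * R) : R :=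
  2^-1 * div (fun q => (Num.sqrt (1 - enorm (grad u q) ^+ 2))^-1 *: grad u q)
             P.1.

(* Main.v *)
Require Import Defs.
From HB Require Import structures.
From mathcomp Require Import all_boot all_order all_algebra.
From mathcomp Require Import all_classical all_reals all_analysis.
From mathcomp Require Import ring lra.

Set Implicit Arguments.
Unset Strict Implicit.
Unset Printing Implicit Defensive.

Import Order.TTheory GRing.Theory Num.Theory.
Import numFieldNormedType.Exports.

Local Open Scope classical_set_scope.
Local Open Scope ring_scope.

(** The graph is bounded by looking at one well-chosen point of a circle.

    Write [W = sqrt (1 + |Du|^2)], [V = sqrt (1 - |Du|^2)], [H] for the common
    mean curvature and [Q = D^2u(Du, Du)].  Expanding the two divergences gives
    two linear equations for [Q] and the laplacian ([equal_mean_curvatures]):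
      [laplacian = H (W^3 + V^3)], [Q (V + W) = - 2 H |Du|^2 W^2 V^2].
    Where [Du <> 0], subtracting the second derivative [Q / |Du|^2] along [Du]
    from the laplacian leaves the second derivative across it,
      [T = H (t + 2 / t)] with [t = V + W],
    and the arithmetic-geometric inequality yields [T >= 2 sqrt 2 H] when [H] is
    positive ([tangential_bound]).

    If [|H| >= m > 0], then [H] has a constant sign, say positive, because the
    laplacian is continuous and does not vanish on a connected set.  On a circle
    of radius [r] in the domain, let [u] be maximal at [q].  There [Du = l n]
    for the outward unit normal [n].  The second derivative of [u] with respect
    to the angle is [r^2 T - r l], and it is nonpositive at a maximum, so
      [r * 2 sqrt 2 m <= r T <= l <= |Du| < 1]
    ([circle_bound]).  Being valid for every disc in the domain, this is the
    announced bound.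

    The argument needs [l <> 0]: [u] has no critical point when [H > 0].
    Indeed [Q <= 0] everywhere, and zooming in at a critical point shows that
    the hessian is nonpositive on the range of the hessian
    ([critical_point_trace]); linear algebra then makes its trace nonpositive
    ([nonpos_on_range_trace]), whereas the laplacian is positive. *)

(** * One-dimensional and directional derivatives *)

Lemma is_derive1_continuous (R : realType) (g : R -> R) (t d : R) :
  is_derive t 1 g d -> {for t, continuous g}.
Proof.
move=> Dg; apply/differentiable_continuous/derivable1_diffP.
exact: ex_derive.
Qed.

Lemma is_derive1_cvgP (R : realType) (g : R -> R) (t d : R) :
  is_derive t 1 g d <-> h^-1 * (g (h + t) - g t) @[h --> 0^'] --> d.
Proof.
have E : (fun h => h^-1 *: ((g \o shift t) (h *: 1) - g t)) =
         (fun h => h^-1 * (g (h + t) - g t)).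
  by apply/funext => h /=; rewrite [h%:A]mulr1.
split=> [[D <-]|D]; first by rewrite /derive E; move: D; rewrite /derivable E.
by constructor; [rewrite /derivable E; apply/cvg_ex; exists d|
                 rewrite /derive E; apply/cvg_lim].
Qed.

Lemma continuous_cvg_dnbhs (R : realType) (g : R -> R) (t : R) :
  {for t, continuous g} -> g (h + t) @[h --> 0^'] --> g t.
Proof.
move=> cg; apply: (@cvg_comp _ _ _ (fun h => h + t) g _ (nbhs t)) cg.
have : (h + t) @[h --> 0^'] --> 0 + t.
  by apply: cvgD; [exact: cvg_within|exact: cvg_cst].
by rewrite add0r.
Qed.

(** The mean value theorem on an unordered segment; keeping [c] no farther
    from [a] than [b] is what makes [c] converge to [a] together with [b]. *)
Lemma MVT_from (R : realType) (f df : R -> R) (a b : R) :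
  (forall x, `|x - a| <= `|b - a| -> is_derive x 1 f (df x)) ->
  exists2 c, `|c - a| <= `|b - a| & f b - f a = df c * (b - a).
Proof.
move=> H.
have C x : `|x - a| <= `|b - a| -> {for x, continuous f}.
  by move=> /H; exact: is_derive1_continuous.
have [ab|ba] := leP a b.
- have dist x : x \in `[a, b] -> `|x - a| <= `|b - a|.
    by rewrite in_itv /= => /andP[ax xb]; rewrite !ger0_norm ?subr_ge0 // lerD2r.
  have [||c /dist cab E] := @MVT_segment R f df a b ab.
  + by move=> x /subset_itv_oo_cc /dist /H.
  + apply: continuous_in_subspaceT => x; rewrite inE /= => /dist; exact: C.
  by exists c.
- have dist x : x \in `[b, a] -> `|x - a| <= `|b - a|.
    rewrite in_itv /= => /andP[bx xa].
    by rewrite !ler0_norm ?subr_le0 // ?lerN2 ?lerD2r // ltW.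
  have [||c /dist cab E] := @MVT_segment R f df b a (ltW ba).
  + by move=> x /subset_itv_oo_cc /dist /H.
  + apply: continuous_in_subspaceT => x; rewrite inE /= => /dist; exact: C.
  by exists c => //; rewrite -opprB E -mulrN opprB.
Qed.

(** The general form from which derivatives along a line, and in particular
    partial derivatives, become derivatives of functions of one variable. *)
Lemma is_derive_same_quotient (R : numFieldType) (U V W : normedModType R)
    (f : U -> W) (g : V -> W) (p v : U) (q w : V) (d : W) :
  (forall h : R, f (h *: v + p) - f p = g (h *: w + q) - g q) ->
  is_derive p v f d <-> is_derive q w g d.
Proof.
move=> fg.
have E : (fun h : R => h^-1 *: ((f \o shift p) (h *: v) - f p)) =
         (fun h => h^-1 *: ((g \o shift q) (h *: w) - g q)).
  by apply/funext => h /=; rewrite fg.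
by split=> -[D <-]; constructor; move: D; rewrite /derivable /derive E.
Qed.

Lemma is_derive_lineP (R : realType) (f : R * R -> R) (p v : R * R) (d : R) :
  is_derive p v f d <-> is_derive (0 : R) 1 (fun t => f (t *: v + p)) d.
Proof.
by apply: is_derive_same_quotient => h; rewrite addr0 [h%:A]mulr1 scale0r add0r.
Qed.

Lemma is_derive_e1P (R : realType) (f : R * R -> R) (x y d : R) :
  is_derive (x, y) (e1 R) f d <-> is_derive x 1 (fun t => f (t, y)) d.
Proof.
apply: is_derive_same_quotient => h; congr (f _ - _).
by congr pair; rewrite /= ?[h *: 0]mulr0 ?add0r.
Qed.

Lemma is_derive_e2P (R : realType) (f : R * R -> R) (x y d : R) :
  is_derive (x, y) (e2 R) f d <-> is_derive y 1 (fun t => f (x, t)) d.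
Proof.
apply: is_derive_same_quotient => h; congr (f _ - _).
by congr pair; rewrite /= ?[h *: 0]mulr0 ?add0r.
Qed.

(** A maximum over two periods may be taken in the interior, since either end
    can be replaced by the midpoint; there the usual conditions on the first
    two derivatives hold. *)
Lemma periodic_max (R : realType) (f f1 f2 : R -> R) (T : R) :
  0 < T -> (forall t, f (t + T) = f t) ->
  (forall t : R, is_derive t 1 f (f1 t)) ->
  (forall t : R, is_derive t 1 f1 (f2 t)) ->
  exists t, f1 t = 0 /\ f2 t <= 0.
Proof.
move=> T0 fT Df D1.
have cf : continuous f.
  by move=> t; exact: is_derive1_continuous (Df t).
have [c c0T cmax] : exists2 c, c \in `]0, T + T[ &
    forall t, t \in `]0, T + T[ -> f t <= f c.
  have [||c cin cmax] := @EVT_max R f 0 (T + T).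
  - by rewrite addr_ge0 // ltW.
  - exact: continuous_subspaceT.
  have cmax' t : t \in `]0, T + T[ -> f t <= f c by move/subset_itv_oo_cc/cmax.
  move: cin; rewrite in_itv /= => /andP[c0 cT].
  (* If [c] is an end of the segment, periodicity moves it to [T]. *)
  have [cin|/negP] := boolP (c \in `]0, T + T[); first by exists c.
  have Tin : T \in `]0, T + T[ by rewrite in_itv /= T0 ltrDl.
  rewrite in_itv /= !lt_neqAle c0 cT !andbT => /negP.
  rewrite negb_and !negbK => /orP[]/eqP E; exists T => // t /cmax'.
    by rewrite -E -(fT 0) add0r.
  by rewrite E fT.
have c1 : f1 c = 0.
  have := @derive1_at_max R f 0 (T + T) c _ _ c0T cmax.
  rewrite addr_ge0 ?ltW // => /(_ isT (fun t _ => ex_derive)).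
  by move/@derive_val; have /@derive_val -> := Df c.
(* If [f2 c > 0], then [f1] is positive just after [c] and [f] increases. *)
exists c; split => //; rewrite leNgt; apply/negP => c2.
have /(@is_derive1_cvgP R) := D1 c; rewrite c1 => lim.
have /nbhs_ballP[e /= e0 pos] :
    nbhs (0 : R) [set h | h != 0 -> 0 < h^-1 * (f1 (h + c) - 0)].
  exact: cvgr_gt lim _ c2.
move: c0T; rewrite in_itv /= => /andP[c0 cT].
pose k := Num.min e (T + T - c) / 2.
have k0 : 0 < k by rewrite divr_gt0 // lt_min e0 subr_gt0.
have [ke kT] : k < e /\ k < T + T - c.
  have [] : Num.min e (T + T - c) <= e /\ Num.min e (T + T - c) <= T + T - c.
    by rewrite !ge_min !lexx orbT.
  by rewrite /k in k0 * => *; split; lra.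
have [||x xin E] := @MVT R f f1 c (c + k).
- by rewrite ltrDl.
- exact: continuous_subspaceT.
move: xin; rewrite in_itv /= => /andP[cx xk].
have := pos (x - c); rewrite /ball /= sub0r normrN gtr0_norm ?subr_gt0 //.
rewrite subrK subr0 => /(_ _ _)/wrap[]; first by lra.
  by rewrite gt_eqF // subr_gt0.
rewrite pmulr_rgt0 ?invr_gt0 ?subr_gt0 // => f1x.
have : 0 < f (c + k) - f c by rewrite E addrAC subrr add0r mulr_gt0.
by rewrite subr_gt0 ltNge cmax // in_itv /=; lra.
Qed.

(** * Continuously differentiable functions of two variables *)

(** Naming the partial derivatives lets the pointwise facts below be stated for
    arbitrary functions, and makes the passage from [u] to [- u] immediate. *)
Definition C1_with (R : realType) (A : set (R * R)) (f fx fy : R * R -> R) :=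
  forall p, A p -> [/\ is_derive p (e1 R) f (fx p), is_derive p (e2 R) f (fy p),
    {for p, continuous fx} & {for p, continuous fy}].

Lemma Cn_on_C1_with (R : realType) (n : nat) (A : set (R * R))
    (f : R * R -> R) :
  Cn_on n.+1 A f -> C1_with A f ('D_(e1 R) f) ('D_(e2 R) f).
Proof.
have Cn_continuous k g : Cn_on k A g -> forall p, A p -> {for p, continuous g}.
  by case: k => [|k] [].
move=> [_ [D1 D2 C1 C2]] p Ap; split.
- by apply: derivableP; exact: D1.
- by apply: derivableP; exact: D2.
- exact: Cn_continuous C1 _ Ap.
- exact: Cn_continuous C2 _ Ap.
Qed.

Lemma C1_withN (R : realType) (A : set (R * R)) (f fx fy : R * R -> R) :
  C1_with A f fx fy -> C1_with A (- f) (- fx) (- fy).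
Proof.
move=> C1f p /C1f[Dx Dy cx cy].
by split; [exact: is_deriveN|exact: is_deriveN|
           exact: continuousN|exact: continuousN].
Qed.

(** Moving first horizontally and then vertically inside a small square
    reduces an increment of [f] to two one-dimensional mean values. *)
Lemma C1_increment (R : realType) (A : set (R * R)) (f fx fy : R * R -> R)
    (p : R * R) : open A -> A p -> C1_with A f fx fy ->
  exists xi eta : R * R -> R * R, [/\ xi q @[q --> p] --> p,
    eta q @[q --> p] --> p &
    \forall q \near p,
      f q - f p = fx (xi q) * (q.1 - p.1) + fy (eta q) * (q.2 - p.2)].
Proof.
move=> oA Ap C1f.
have /nbhs_ballP[r /= r0 rA] : nbhs p A by exact: open_nbhs_nbhs.
have step q : exists z : (R * R) * (R * R), ball p r q ->
    [/\ forall e, ball p e q -> ball p e z.1 /\ ball p e z.2 &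
     f q - f p = fx z.1 * (q.1 - p.1) + fy z.2 * (q.2 - p.2)].
  have [pq|npq] := pselect (ball p r q); last by exists (p, p).
  move: p q Ap rA pq => [p1 p2] [q1 q2] Ap rA [/= pq1 pq2].
  have near_p x y : `|x - p1| <= `|q1 - p1| -> `|y - p2| <= `|q2 - p2| ->
      forall e, ball (p1, p2) e (q1, q2) -> ball (p1, p2) e (x, y).
    move=> xq yq e [/= b1 b2]; split=> /=; rewrite /ball /= distrC.
      by apply: le_lt_trans xq _; rewrite distrC.
    by apply: le_lt_trans yq _; rewrite distrC.
  have inA x y : `|x - p1| <= `|q1 - p1| -> `|y - p2| <= `|q2 - p2| -> A (x, y).
    by move=> xq yq; apply: rA; apply: near_p.
  have [|x xq Ex] := @MVT_from R (fun t => f (t, q2)) (fun t => fx (t, q2)) p1 q1.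
    by move=> x xq; apply/is_derive_e1P; have [] := C1f _ (inA _ q2 xq (lexx _)).
  have [|y yq Ey] := @MVT_from R (fun t => f (p1, t)) (fun t => fy (p1, t)) p2 q2.
    move=> y yq; apply/is_derive_e2P.
    by have [] := C1f _ (inA p1 _ _ yq); rewrite ?subrr ?normr0.
  exists ((x, q2), (p1, y)) => _; split => [e pe|/=].
    by split; apply: near_p => //=; rewrite ?subrr ?normr0.
  by rewrite -Ex -Ey addrA subrK.
have [z zP] := choice step.
have lim_p (g : R * R -> R * R) :
    (forall q, ball p r q -> forall e, ball p e q -> ball p e (g q)) ->
    g q @[q --> p] --> p.
  move=> gP; apply/cvg_ballP => e e0.
  have := @filterI _ _ (nbhs_filter p) _ _ (nbhsx_ballx p r r0)
    (nbhsx_ballx p e e0).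
  by apply: (@filterS _ _ (nbhs_filter p)) => q [rq eq]; exact: gP.
exists (fun q => (z q).1), (fun q => (z q).2); split.
- by apply: lim_p => q /zP[+ _] e pe => /(_ e pe)[].
- by apply: lim_p => q /zP[+ _] e pe => /(_ e pe)[].
- by apply: (@filterS _ _ (nbhs_filter p)) (nbhsx_ballx p r r0) => q /zP[].
Qed.

(** Divided by the step, the two terms of [C1_increment] converge to the two
    terms of the derivative, since [fx] and [fy] are continuous. *)
Lemma C1_with_chain (R : realType) (A : set (R * R)) (f fx fy : R * R -> R)
    (x y : R -> R) (t dx dy : R) :
  open A -> C1_with A f fx fy -> A (x t, y t) ->
  is_derive t 1 x dx -> is_derive t 1 y dy ->
  is_derive t 1 (fun s => f (x s, y s))
    (fx (x t, y t) * dx + fy (x t, y t) * dy).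
Proof.
move=> oA C1f At Dx Dy; apply/is_derive1_cvgP.
have [xi [eta [xiP etaP inc]]] := C1_increment oA At C1f.
have [_ _ cfx cfy] := C1f _ At.
set p := (x t, y t).
have cp : (x (h + t), y (h + t)) @[h --> 0^'] --> p.
  apply: (@cvg_pair _ _ _ _ _ _ _ (nbhs_filter (x t)) (nbhs_filter (y t)));
  exact/continuous_cvg_dnbhs/is_derive1_continuous.
have limxi : fx (xi (x (h + t), y (h + t))) @[h --> 0^'] --> fx p.
  apply: (@cvg_comp _ _ _ (fun h => xi (x (h + t), y (h + t))) fx _ (nbhs p)) cfx.
  exact: (@cvg_comp _ _ _ (fun h => (x (h + t), y (h + t))) xi _ (nbhs p)).
have limeta : fy (eta (x (h + t), y (h + t))) @[h --> 0^'] --> fy p.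
  apply: (@cvg_comp _ _ _ (fun h => eta (x (h + t), y (h + t))) fy _ (nbhs p)) cfy.
  exact: (@cvg_comp _ _ _ (fun h => (x (h + t), y (h + t))) eta _ (nbhs p)).
have lim : fx (xi (x (h + t), y (h + t))) * (h^-1 * (x (h + t) - x t)) +
    fy (eta (x (h + t), y (h + t))) * (h^-1 * (y (h + t) - y t))
    @[h --> 0^'] --> fx p * dx + fy p * dy.
  by apply: cvgD; apply: cvgM => //; apply/is_derive1_cvgP.
refine (cvg_trans _ lim); apply: near_eq_cvg.
have := cp _ inc; rewrite /nbhs /=; apply: filterS => h /= ->.
by ring.
Qed.

(** * Algebra of the two mean curvature equations *)

(** If the matrix [M] with rows [(a, b)] and [(c, d)] is invertible, its range
    contains the coordinate vectors, so [a] and [d] are nonpositive.  Otherwise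
    [a d = b c], and evaluating at the columns of [M] gives the trace times
    their squared norms; a positive trace would force both columns to vanish. *)
Lemma nonpos_on_range_trace (R : realType) (a b c d : R) :
  (forall v1 v2, let w1 := a * v1 + b * v2 in let w2 := c * v1 + d * v2 in
     a * w1 ^+ 2 + (b + c) * w1 * w2 + d * w2 ^+ 2 <= 0) ->
  a + d <= 0.
Proof.
move=> neg; rewrite leNgt; apply/negP => tr.
have nonpos0 x : (a + d) * x <= 0 -> 0 <= x -> x = 0.
  rewrite pmulr_rle0 // => x0 x0'; apply/eqP; rewrite eq_le; exact/andP.
have det0 : a * d - b * c = 0.
  (* The matrix sends the columns of its adjugate to the coordinate vectors
     times the determinant. *)
  apply/eqP; rewrite -sqrf_eq0; apply/eqP/nonpos0; last exact: sqr_ge0.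
  apply: le_trans (_ : 0 + 0 <= 0); last by rewrite addr0.
  by apply: le_trans (lerD (neg d (- c)) (neg (- b) a)); rewrite le_eqVlt /=;
    apply/orP; left; apply/eqP; ring.
have [col1 col2] : a ^+ 2 + c ^+ 2 = 0 /\ b ^+ 2 + d ^+ 2 = 0.
  split; apply: nonpos0; rewrite ?addr_ge0 ?sqr_ge0 //.
    apply: le_trans (neg 1 0); rewrite le_eqVlt /=; apply/orP; left.
    rewrite -subr_eq0; apply/eqP.
    by transitivity (a * (a * d - b * c)); [ring|rewrite det0 mulr0].
  apply: le_trans (neg 0 1); rewrite le_eqVlt /=; apply/orP; left.
  rewrite -subr_eq0; apply/eqP.
  by transitivity (d * (a * d - b * c)); [ring|rewrite det0 mulr0].
have a0 : a = 0.
  apply/eqP; move/eqP: col1.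
  by rewrite paddr_eq0 ?sqr_ge0 // !sqrf_eq0 => /andP[].
have d0 : d = 0.
  apply/eqP; move/eqP: col2.
  by rewrite paddr_eq0 ?sqr_ge0 // !sqrf_eq0 => /andP[].
by move: tr; rewrite a0 d0 addr0 ltxx.
Qed.

(** Clearing denominators gives [W^2 lap - Q = 2 H W^3] and
    [V^2 lap + Q = 2 H V^3]; since [W^2 + V^2 = 2], their sum determines [lap],
    and then either of them determines [Q]. *)
Lemma equal_mean_curvatures (R : realType) (sigma lap Q H : R) :
  0 <= sigma < 1 ->
  let W := Num.sqrt (1 + sigma) in let V := Num.sqrt (1 - sigma) in
  lap / W - Q / W ^+ 3 = 2 * H -> lap / V + Q / V ^+ 3 = 2 * H ->
  lap = H * (W ^+ 3 + V ^+ 3) /\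
  Q * (V + W) = - (2 * H * sigma * W ^+ 2 * V ^+ 2).
Proof.
move=> /andP[s0 s1] W V.
have W0 : 0 < W by rewrite sqrtr_gt0; lra.
have V0 : 0 < V by rewrite sqrtr_gt0; lra.
have W2 : W ^+ 2 = 1 + sigma by rewrite sqr_sqrtr //; lra.
have V2 : V ^+ 2 = 1 - sigma by rewrite sqr_sqrtr //; lra.
move=> eW eV.
have {}eW : lap * W ^+ 2 - Q = 2 * H * W ^+ 3.
  by rewrite -eW; field; rewrite gt_eqF.
have {}eV : lap * V ^+ 2 + Q = 2 * H * V ^+ 3.
  by rewrite -eV; field; rewrite gt_eqF.
have L : lap = H * (W ^+ 3 + V ^+ 3).
  have : lap * (W ^+ 2 + V ^+ 2) = 2 * H * (W ^+ 3 + V ^+ 3).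
    by rewrite mulrDr mulrDr -eW -eV; ring.
  by rewrite W2 V2 => E; lra.
split=> //.
have -> : Q = lap * W ^+ 2 - 2 * H * W ^+ 3 by rewrite -eW; ring.
have sE : sigma = (W ^+ 2 - V ^+ 2) / 2 by rewrite W2 V2; field.
have twoE : 2 = W ^+ 2 + V ^+ 2 by rewrite W2 V2; ring.
rewrite L sE.
transitivity (H * W ^+ 2 * (W ^+ 3 + V ^+ 3 - 2 * W) * (V + W)); first by ring.
by rewrite [in LHS]twoE; field.
Qed.

(** [N] and [T] are the second derivatives along the gradient and across it.
    With [t = V + W] one gets [T t = H (2 + t^2)], and [2 + t^2 >= 2 sqrt 2 t]
    is [(t - sqrt 2)^2 >= 0]; equality is approached as [sigma] tends to [1]. *)
Lemma tangential_bound (R : realType) (sigma N T H : R) :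
  0 <= sigma < 1 -> 0 < H ->
  let W := Num.sqrt (1 + sigma) in let V := Num.sqrt (1 - sigma) in
  N + T = H * (W ^+ 3 + V ^+ 3) ->
  N * (V + W) = - (2 * H * W ^+ 2 * V ^+ 2) ->
  2 * Num.sqrt 2 * H <= T.
Proof.
move=> /andP[s0 s1] H0 W V lap eN.
have W0 : 0 < W by rewrite sqrtr_gt0; lra.
have V0 : 0 < V by rewrite sqrtr_gt0; lra.
have W2 : W ^+ 2 = 1 + sigma by rewrite sqr_sqrtr //; lra.
have V2 : V ^+ 2 = 1 - sigma by rewrite sqr_sqrtr //; lra.
have eT : T * (V + W) = H * (2 + (V + W) ^+ 2).
  have -> : T = H * (W ^+ 3 + V ^+ 3) - N by rewrite -lap; ring.
  rewrite mulrBl eN.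
  transitivity (H * ((W ^+ 2 + V ^+ 2) ^+ 2 + V * W * (W ^+ 2 + V ^+ 2))).
    by ring.
  have -> : (V + W) ^+ 2 = (W ^+ 2 + V ^+ 2) + 2 * (V * W) by ring.
  by rewrite W2 V2; ring.
have t0 : 0 < V + W by exact: addr_gt0.
rewrite -(ler_pM2r t0) eT.
have := sqr_ge0 (V + W - Num.sqrt 2).
rewrite sqrrB sqr_sqrtr // => sq.
rewrite -subr_ge0.
have -> : H * (2 + (V + W) ^+ 2) - 2 * Num.sqrt 2 * H * (V + W) =
  H * ((V + W) ^+ 2 - (V + W) * Num.sqrt 2 *+ 2 + 2) by ring.
by rewrite mulr_ge0 // ltW.
Qed.

(** * Critical points and maxima on circles *)

(** Here [(p, s)] plays the part of the gradient.  At [z + h v] it is [h M v] up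
    to [o(h)], with [M] its jacobian at [z]; dividing the hypothesis by [h^2]
    and letting [h] tend to [0] shows that the quadratic form of [M] is
    nonpositive at [M v].  No symmetry of [M] is assumed, whence the
    coefficient [b + c]. *)
Lemma critical_point_trace (R : realType) (A : set (R * R))
    (p s a b c d : R * R -> R) (z : R * R) :
  open A -> C1_with A p a b -> C1_with A s c d ->
  (forall q, A q ->
     a q * p q ^+ 2 + (b q + c q) * p q * s q + d q * s q ^+ 2 <= 0) ->
  A z -> p z = 0 -> s z = 0 -> a z + d z <= 0.
Proof.
move=> oA Cp Cs neg Az pz sz; apply: (@nonpos_on_range_trace _ _ (b z) (c z)).
move=> v1 v2 /=.
pose x h : R := h * v1 + z.1; pose y h : R := h * v2 + z.2.
have line (v k : R) : is_derive (0 : R) 1 (fun h : R => h * v + k) v.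
  apply/is_derive1_cvgP.
  refine (@cvg_trans _ (cst v @ (0 : R)^') _ _ _ (cvg_cst _)).
  apply: near_eq_cvg; near=> h => /=.
  have h0 : h != 0 by near: h; exact: nbhs_dnbhs_neq.
  by field.
have z0 : (x 0, y 0) = z by rewrite /x /y !mul0r !add0r; case: (z).
have A0 : A (x 0, y 0) by rewrite z0.
have Dp := C1_with_chain oA Cp A0 (line v1 z.1) (line v2 z.2).
have Ds := C1_with_chain oA Cs A0 (line v1 z.1) (line v2 z.2).
rewrite -/x -/y !z0 in Dp Ds.
pose g h := (x h, y h).
have lim_line (v k : R) : (h * v + k) @[h --> (0 : R)^'] --> 0 * v + k.
  apply: cvgD; last exact: cvg_cst.
  by apply: cvgM; [exact: cvg_within|exact: cvg_cst].
have cg : g h @[h --> (0 : R)^'] --> z.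
  rewrite -[X in _ --> X]z0.
  apply: (@cvg_pair _ _ _ _ _ _ _ (nbhs_filter (x 0)) (nbhs_filter (y 0)));
  exact: lim_line.
have along (k : R * R -> R) :
    {for z, continuous k} -> k (g h) @[h --> (0:R)^'] --> k z.
  by move=> ck; apply: (@cvg_comp _ _ _ g k _ (nbhs z)) ck.
have quot (k : R -> R) e : k 0 = 0 -> is_derive (0 : R) 1 k e ->
    h^-1 * k h @[h --> (0 : R)^'] --> e.
  move=> k0 /is_derive1_cvgP; rewrite k0.
  by rewrite (_ : (fun h => _) = (fun h => h^-1 * k h)) //;
    apply/funext => h; rewrite addr0 subr0.
have {}Dp := quot (fun h => p (g h)) _ (etrans (congr1 p z0) pz) Dp.
have {}Ds := quot (fun h => s (g h)) _ (etrans (congr1 s z0) sz) Ds.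
have [_ _ /along ca /along cb] := Cp _ Az.
have [_ _ /along cc /along cd] := Cs _ Az.
pose P h := h^-1 * p (g h); pose S h := h^-1 * s (g h).
have lim : a (g h) * (P h * P h) + (b (g h) + c (g h)) * (P h * S h) +
    d (g h) * (S h * S h) @[h --> (0 : R)^'] -->
    a z * ((a z * v1 + b z * v2) * (a z * v1 + b z * v2)) +
    (b z + c z) * ((a z * v1 + b z * v2) * (c z * v1 + d z * v2)) +
    d z * ((c z * v1 + d z * v2) * (c z * v1 + d z * v2)).
  apply: cvgD; [apply: cvgD|]; apply: cvgM => //; try exact: cvgM.
  exact: cvgD.
rewrite !expr2 -mulrA; apply: (cvgr_to_le lim).
have Ag : \forall h \near (0 : R)^', A (g h) by apply: cg; exact: open_nbhs_nbhs.
apply: filterS Ag => h /= /neg neg_h.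
rewrite [X in X <= _](_ : _ = h^-1 ^+ 2 * (a (g h) * p (g h) ^+ 2 +
  (b (g h) + c (g h)) * p (g h) * s (g h) + d (g h) * s (g h) ^+ 2)).
  by rewrite mulr_ge0_le0 ?sqr_ge0.
by rewrite /P /S; ring.
Unshelve. all: by end_near. Qed.

(** At the maximum of [u] on the circle, the gradient is [l] times the outward
    normal [(co, si)], and the sign of the second derivative in the angle reads
    [r T <= l], where [T] is the second derivative of [u] along the tangent. *)
Lemma circle_bound (R : realType) (A : set (R * R))
    (u p s a b c d H : R * R -> R) (x0 y0 r m : R) :
  open A -> C1_with A u p s -> C1_with A p a b -> C1_with A s c d ->
  (forall z, A z -> p z ^+ 2 + s z ^+ 2 < 1) ->
  0 < m -> (forall z, A z -> m <= H z) ->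
  (forall z, A z -> let sigma := p z ^+ 2 + s z ^+ 2 in
     let W := Num.sqrt (1 + sigma) in let V := Num.sqrt (1 - sigma) in
     a z + d z = H z * (W ^+ 3 + V ^+ 3) /\
     (a z * p z ^+ 2 + (b z + c z) * p z * s z + d z * s z ^+ 2) * (V + W) =
       - (2 * H z * sigma * W ^+ 2 * V ^+ 2)) ->
  0 < r -> (forall t, A (x0 + r * cos t, y0 + r * sin t)) ->
  r * (2 * Num.sqrt 2 * m) < 1.
Proof.
move=> oA Cu Cp Cs slope m0 mH curv r0 circ.
have sqrt_gt0 z : A z -> 0 < Num.sqrt (1 - (p z ^+ 2 + s z ^+ 2)) /\
    0 < Num.sqrt (1 + (p z ^+ 2 + s z ^+ 2)).
  move=> Az; rewrite !sqrtr_gt0 subr_gt0 slope //; split => //.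
  by rewrite ltr_wpDr ?addr_ge0 ?sqr_ge0.
(* The curvature equations make the quadratic form of the hessian nonpositive at
   the gradient, while the laplacian is positive. *)
have nocrit z : A z -> ~ (p z = 0 /\ s z = 0).
  move=> Az [pz sz]; have := critical_point_trace oA Cp Cs _ Az pz sz.
  have [+ _] := curv _ Az; rewrite /= => ->; rewrite leNgt => /(_ _)/negP[].
    move=> q Aq; have [V0 W0] := sqrt_gt0 _ Aq; have [_ /=] := curv _ Aq.
    move=> Q; rewrite -(pmulr_lle0 _ (addr_gt0 V0 W0)) Q oppr_le0.
    by rewrite !mulr_ge0 ?addr_ge0 ?sqr_ge0 // (le_trans (ltW m0)) ?mH.
  have [V0 W0] := sqrt_gt0 _ Az.
  by rewrite mulr_gt0 ?addr_gt0 ?exprn_gt0 // (lt_le_trans m0) ?mH.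
pose g t : R * R := (x0 + r * cos t, y0 + r * sin t).
have Drc (t : R) : is_derive t 1 (fun t : R => r * cos t) (- (r * sin t)).
  by rewrite -mulrN; exact: is_deriveZ.
have Drs (t : R) : is_derive t 1 (fun t : R => r * sin t) (r * cos t).
  exact: is_deriveZ.
have Dx (t : R) : is_derive t 1 (fun t : R => x0 + r * cos t) (- (r * sin t)).
  by rewrite -[X in is_derive _ _ _ X]add0r; exact: is_deriveD.
have Dy (t : R) : is_derive t 1 (fun t : R => y0 + r * sin t) (r * cos t).
  by rewrite -[X in is_derive _ _ _ X]add0r; exact: is_deriveD.
have chain f fx fy (t : R) : C1_with A f fx fy -> is_derive t 1 (f \o g)
    (fx (g t) * - (r * sin t) + fy (g t) * (r * cos t)).
  move=> Cf; exact: (@C1_with_chain _ _ _ _ _ (fun t => x0 + r * cos t)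
    (fun t => y0 + r * sin t) _ _ _ oA Cf (circ t) (Dx t) (Dy t)).
have Du t := chain _ _ _ t Cu.
have Dp t := chain _ _ _ t Cp.
have Ds t := chain _ _ _ t Cs.
have D2u (t : R) : is_derive t 1
   (fun t : R => p (g t) * - (r * sin t) + s (g t) * (r * cos t))
   (r ^+ 2 * (a (g t) * sin t ^+ 2 - (b (g t) + c (g t)) * sin t * cos t +
      d (g t) * cos t ^+ 2) - r * (p (g t) * cos t + s (g t) * sin t)).
  have DrsN : is_derive t 1 (fun t : R => - (r * sin t)) (- (r * cos t)).
    exact: is_deriveN.
  apply: (is_derive_eq (is_deriveD (is_deriveM (Dp t) DrsN)
                                   (is_deriveM (Ds t) (Drc t)))).
  by rewrite /= /GRing.scale /=; ring.
have per (t : R) : (u \o g) (t + pi *+ 2) = (u \o g) t.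
  by rewrite /= /g cosD2pi sinD2pi.
have [t [crit1 crit2]] := periodic_max (mulrn_wgt0 2 (pi_gt0 R)) per Du D2u.
have Ag := circ t; rewrite -/(g t) in Ag.
set q := g t in crit1 crit2 Ag.
set co := cos t in crit1 crit2; set si := sin t in crit1 crit2.
have trig : co ^+ 2 + si ^+ 2 = 1 by rewrite cos2Dsin2.
pose l := p q * co + s q * si.
have tang : s q * co - p q * si = 0.
  apply: (mulfI (lt0r_neq0 r0)); rewrite mulr0 -crit1; ring.
have pE : p q = l * co.
  transitivity (p q * (co ^+ 2 + si ^+ 2) + (s q * co - p q * si) * si).
    by rewrite trig tang; ring.
  by rewrite /l; ring.
have sE : s q = l * si.
  transitivity (s q * (co ^+ 2 + si ^+ 2) - (s q * co - p q * si) * co).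
    by rewrite trig tang; ring.
  by rewrite /l; ring.
have sigmaE : p q ^+ 2 + s q ^+ 2 = l ^+ 2.
  by rewrite pE sE -[RHS]mulr1 -trig; ring.
have l0 : l != 0.
  by apply/eqP => l0; apply: (nocrit q Ag); rewrite pE sE l0 !mul0r.
have l1 : l < 1.
  have := slope q Ag; rewrite sigmaE => l2.
  by rewrite ltNge; apply/negP => l1; move: l2; rewrite ltNge exprn_ege1.
have [lap curvQ] := curv q Ag.
rewrite sigmaE in lap curvQ.
pose N := a q * co ^+ 2 + (b q + c q) * co * si + d q * si ^+ 2.
pose T := a q * si ^+ 2 - (b q + c q) * si * co + d q * co ^+ 2.
have lapNT : N + T = a q + d q.
  by rewrite -[RHS]mulr1 -trig /N /T; ring.
have Hq : 0 < H q by rewrite (lt_le_trans m0) ?mH.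
have Tbound : 2 * Num.sqrt 2 * H q <= T.
  apply: (@tangential_bound _ (l ^+ 2) N) => //.
  - by rewrite sqr_ge0 -sigmaE slope.
  - by rewrite lapNT.
  - apply: (mulfI (expf_neq0 2 l0)).
    transitivity (- (2 * H q * l ^+ 2 * Num.sqrt (1 + l ^+ 2) ^+ 2 *
                     Num.sqrt (1 - l ^+ 2) ^+ 2)); last by ring.
    by rewrite -curvQ pE sE /N; ring.
have rT : r * T <= l.
  rewrite -(ler_pM2l r0) -subr_le0; apply: le_trans crit2.
  by rewrite /T /l le_eqVlt; apply/orP; left; apply/eqP; ring.
apply: le_lt_trans l1; apply: le_trans rT.
rewrite ler_pM2l //; apply: le_trans Tbound.
by rewrite ler_pM2l ?mH // mulr_gt0 // sqrtr_gt0.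
Qed.

(** * Mean curvatures in terms of second derivatives *)

Lemma enorm_sq (R : realType) (v : R * R) : enorm v ^+ 2 = v.1 ^+ 2 + v.2 ^+ 2.
Proof. by rewrite /enorm sqr_sqrtr // addr_ge0 ?sqr_ge0. Qed.

(** The sign [k] is [1] for the Euclidean and [-1] for the Lorentzian mean
    curvature. *)
Lemma is_derive_normalized (R : realType) (k : R) (p s f : R * R -> R)
    (z v : R * R) (dp ds df : R) :
  let w q := 1 + k * (p q ^+ 2 + s q ^+ 2) in
  0 < w z ->
  is_derive z v p dp -> is_derive z v s ds -> is_derive z v f df ->
  is_derive z v (fun q => (Num.sqrt (w q))^-1 * f q)
    (df / Num.sqrt (w z) -
     k * f z * (p z * dp + s z * ds) / Num.sqrt (w z) ^+ 3).
Proof.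
move=> w w0 /is_derive_lineP Dp /is_derive_lineP Ds /is_derive_lineP Df.
apply/is_derive_lineP.
pose g (t : R) := t *: v + z.
have g0 : g 0 = z by rewrite /g scale0r add0r.
have Dp2 : is_derive (0 : R) 1 (fun t => p (g t) ^+ 2) (p z * dp *+ 2).
  apply: (is_derive_eq (is_deriveM Dp Dp)).
  by rewrite /= scale0r add0r /GRing.scale /=; ring.
have Ds2 : is_derive (0 : R) 1 (fun t => s (g t) ^+ 2) (s z * ds *+ 2).
  apply: (is_derive_eq (is_deriveM Ds Ds)).
  by rewrite /= scale0r add0r /GRing.scale /=; ring.
have Dw : is_derive (0 : R) 1 (w \o g) (k * (p z * dp *+ 2 + s z * ds *+ 2)).
  refine (is_derive_eq (is_deriveD (is_derive_cst (1 : R) (0 : R) 1)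
    (is_deriveZ k (is_deriveD Dp2 Ds2))) _).
  by rewrite add0r.
have Dsq : is_derive (0 : R) 1 (Num.sqrt \o (w \o g))
    ((2 * Num.sqrt (w z))^-1 * (k * (p z * dp *+ 2 + s z * ds *+ 2))).
  by apply: is_derive1_comp; rewrite /= g0; exact: is_derive1_sqrt.
have sq0 : Num.sqrt (w z) != 0 by rewrite gt_eqF // sqrtr_gt0.
have sqg0 : (Num.sqrt \o (w \o g)) 0 != 0 by rewrite /= g0.
have Dinv := is_deriveV sqg0 Dsq.
apply: (is_derive_eq (is_deriveM Dinv Df)).
rewrite /= scale0r add0r g0 /GRing.scale /=; field; exact: sq0.
Qed.

Lemma div_normalized (R : realType) (k : R) (A : set (R * R))
    (p s a b c d : R * R -> R) (z : R * R) :
  let W := Num.sqrt (1 + k * (p z ^+ 2 + s z ^+ 2)) in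
  C1_with A p a b -> C1_with A s c d -> A z ->
  0 < 1 + k * (p z ^+ 2 + s z ^+ 2) ->
  div (fun q => (Num.sqrt (1 + k * (p q ^+ 2 + s q ^+ 2)))^-1 *: (p q, s q)) z =
  (a z + d z) / W -
  k * (a z * p z ^+ 2 + (b z + c z) * p z * s z + d z * s z ^+ 2) / W ^+ 3.
Proof.
move=> W Cp Cs Az w0; have [Da Db _ _] := Cp z Az; have [Dc Dd _ _] := Cs z Az.
rewrite /div.
have [_ /= ->] := is_derive_normalized w0 Da Dc Da.
have [_ /= ->] := is_derive_normalized w0 Db Dd Dd.
by rewrite -/W; field; rewrite gt_eqF // sqrtr_gt0.
Qed.

Lemma HR_C2E (R : realType) (A : set (R * R)) (u p s a b c d : R * R -> R)
    (z : R * R) (t : R) :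
  (forall q, grad u q = (p q, s q)) ->
  C1_with A p a b -> C1_with A s c d -> A z ->
  let W := Num.sqrt (1 + (p z ^+ 2 + s z ^+ 2)) in
  (a z + d z) / W -
    (a z * p z ^+ 2 + (b z + c z) * p z * s z + d z * s z ^+ 2) / W ^+ 3 =
  2 * HR u (z, t).
Proof.
move=> gradE Cp Cs Az W.
have normE : (fun q => (Num.sqrt (1 + enorm (grad u q) ^+ 2))^-1 *: grad u q) =
    (fun q => (Num.sqrt (1 + 1 * (p q ^+ 2 + s q ^+ 2)))^-1 *: (p q, s q)).
  by apply/funext => q; rewrite enorm_sq gradE /= mul1r.
rewrite (congr1 (fun F => 2^-1 * div F z) normE : HR u (z, t) = _).
rewrite mulVKf ?pnatr_eq0 // (div_normalized Cp Cs Az) !mul1r //.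
by rewrite ltr_wpDr ?addr_ge0 ?sqr_ge0.
Qed.

Lemma HL_C2E (R : realType) (A : set (R * R)) (u p s a b c d : R * R -> R)
    (z : R * R) (t : R) :
  (forall q, grad u q = (p q, s q)) ->
  C1_with A p a b -> C1_with A s c d -> A z -> p z ^+ 2 + s z ^+ 2 < 1 ->
  let V := Num.sqrt (1 - (p z ^+ 2 + s z ^+ 2)) in
  (a z + d z) / V +
    (a z * p z ^+ 2 + (b z + c z) * p z * s z + d z * s z ^+ 2) / V ^+ 3 =
  2 * HL u (z, t).
Proof.
move=> gradE Cp Cs Az slope V.
have normE : (fun q => (Num.sqrt (1 - enorm (grad u q) ^+ 2))^-1 *: grad u q) =
    (fun q => (Num.sqrt (1 + -1 * (p q ^+ 2 + s q ^+ 2)))^-1 *: (p q, s q)).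
  by apply/funext => q; rewrite enorm_sq gradE /= mulN1r.
rewrite (congr1 (fun F => 2^-1 * div F z) normE : HL u (z, t) = _).
rewrite mulVKf ?pnatr_eq0 // (div_normalized Cp Cs Az) !mulN1r ?subr_gt0 //.
by rewrite mulNr opprK.
Qed.

(** * The bound on the radius *)

Lemma continuous_nonvanishing_sign (R : realType) (T : topologicalType)
    (A : set T) (f : T -> R) :
  connected A -> (forall p, A p -> {for p, continuous f}) ->
  (forall p, A p -> f p != 0) ->
  (forall p, A p -> 0 < f p) \/ (forall p, A p -> f p < 0).
Proof.
move=> cA cf f0; apply: contrapT => /not_orP[].
move=> /existsNP[p /not_implyP[Ap fp]] /existsNP[q /not_implyP[Aq fq]].
have itv : is_interval (f @` A).
  apply/connected_intervalP/connected_continuous_connected => //.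
  by apply: continuous_in_subspaceT => x; rewrite inE; exact: cf.
have [|z Az /eqP] := itv (f p) (f q) (imageP f Ap) (imageP f Aq) 0.
  by rewrite !leNgt; apply/andP; split; apply/negP.
exact/negP/f0.
Qed.

(** The hypotheses of [circle_bound] hold for [u], or for [- u], according to the
    sign of [H], which is that of the laplacian [a + d]. *)
Lemma equal_HR_HL_bound (R : realType) (A : set (R * R))
    (u p s a b c d : R * R -> R) (o : R * R) (r m : R) :
  open A -> connected A -> (forall q, grad u q = (p q, s q)) ->
  C1_with A u p s -> C1_with A p a b -> C1_with A s c d ->
  (forall z, A z -> enorm (grad u z) < 1) ->
  (forall z, A z -> HR u (z, u z) = HL u (z, u z)) ->
  0 < m -> (forall z, A z -> m <= `|HR u (z, u z)|) ->
  0 < r -> closed_disc o r `<=` A -> r * (2 * Num.sqrt 2 * m) < 1.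
Proof.
move=> oA cA gradE Cu Cp Cs Du1 eqH m0 mH r0 disc.
pose H z := HR u (z, u z).
have slope z : A z -> p z ^+ 2 + s z ^+ 2 < 1.
  move=> /Du1; rewrite gradE -(enorm_sq (p z, s z)) => lt1.
  by rewrite expr_lt1 // sqrtr_ge0.
have curv z : A z -> let sigma := p z ^+ 2 + s z ^+ 2 in
     let W := Num.sqrt (1 + sigma) in let V := Num.sqrt (1 - sigma) in
     a z + d z = H z * (W ^+ 3 + V ^+ 3) /\
     (a z * p z ^+ 2 + (b z + c z) * p z * s z + d z * s z ^+ 2) * (V + W) =
       - (2 * H z * sigma * W ^+ 2 * V ^+ 2).
  move=> Az /=; apply: equal_mean_curvatures.
  - by rewrite slope // addr_ge0 ?sqr_ge0.
  - exact: HR_C2E gradE Cp Cs Az.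
  - by rewrite /H eqH //; exact: HL_C2E gradE Cp Cs Az (slope z Az).
have wpos z : A z -> 0 < Num.sqrt (1 + (p z ^+ 2 + s z ^+ 2)) ^+ 3 +
      Num.sqrt (1 - (p z ^+ 2 + s z ^+ 2)) ^+ 3.
  move=> Az; have sz := slope z Az.
  have s0 : 0 <= p z ^+ 2 + s z ^+ 2 by rewrite addr_ge0 ?sqr_ge0.
  by rewrite addr_gt0 // exprn_gt0 // sqrtr_gt0; lra.
have circ t : A (o.1 + r * cos t, o.2 + r * sin t).
  apply: disc; rewrite /closed_disc /= /enorm /= !(addrC _ (r * _)) !addrK.
  by rewrite !exprMn -mulrDr cos2Dsin2 mulr1 sqrtr_sqr ger0_norm // ltW.
have lap0 z : A z -> a z + d z != 0.
  move=> Az; have [-> _] := curv z Az; rewrite mulf_neq0 ?(gt_eqF (wpos z Az)) //.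
  by rewrite -normr_gt0 (lt_le_trans m0) ?mH.
have clap z : A z -> {for z, continuous (fun q => a q + d q)}.
  move=> Az; have [_ _ ca _] := Cp z Az; have [_ _ _ cd] := Cs z Az.
  exact: continuousD.
have [pos|neg] := continuous_nonvanishing_sign cA clap lap0.
- apply: (circle_bound (H := H) oA Cu Cp Cs) r0 circ => // z Az.
  have := pos z Az; have [-> _] := curv z Az.
  by rewrite pmulr_lgt0 ?wpos // => Hz; rewrite -[H z]gtr0_norm // mH.
- apply: (circle_bound (H := - H) oA (C1_withN Cu) (C1_withN Cp) (C1_withN Cs))
    r0 circ => // z Az.
  + by rewrite /= !sqrrN slope.
  + have := neg z Az; have [-> _] := curv z Az.
    by rewrite pmulr_llt0 ?wpos // => Hz; rewrite -[(- H) z]ltr0_norm // mH.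
  + have [lap Q] := curv z Az.
    have oppE (f : R * R -> R) : (- f) z = - f z by [].
    rewrite /= !oppE !sqrrN -opprD lap mulNr; split=> //.
    apply: oppr_inj; transitivity (- (2 * H z * (p z ^+ 2 + s z ^+ 2) *
      Num.sqrt (1 + (p z ^+ 2 + s z ^+ 2)) ^+ 2 *
      Num.sqrt (1 - (p z ^+ 2 + s z ^+ 2)) ^+ 2)); last by ring.
    by rewrite -Q; ring.
Qed.

(* The inverse is that of the extended reals, for which 0^-1 = +oo. *)
Theorem theorem2 (R : realType) (Omega : set (R * R)) (u : R * R -> R)
    (hOmega : domain Omega)
    (hu : smooth_on Omega u)
    (hDu : forall p : R * R, Omega p -> enorm (grad u p) < 1)
    (hH : forall P : R * R * R, graph_of Omega u P -> HR u P = HL u P) :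
  (inradius Omega <=
    ((2 * Num.sqrt 2)%:E *
       ereal_inf [set `|HR u P|%:E | P in graph_of Omega u])^-1)%E.
Proof.
apply: ge_ereal_sup => _ [r [r0 [c disc]] <-].
have [[p0 Op0] _ _] := hOmega.
set I := ereal_inf _.
have graphP p : Omega p -> graph_of Omega u (p, u p) by exists p.
have I0 : (0 <= I)%E by apply: le_ereal_inf_tmp => _ [P _ <-]; rewrite lee_fin.
have Ile p : Omega p -> (I <= `|HR u (p, u p)|%:E)%E.
  by move=> Op; apply: ereal_inf_lbound; exists (p, u p) => //; exact: graphP.
case: I I0 Ile => [m||] I0 Ile //; last by have := Ile p0 Op0.
have [m0|m0|<-] := ltgtP 0 m; last by rewrite mule0 inve0 leey.
  have q0 : 0 < 2 * Num.sqrt 2 * m by rewrite !mulr_gt0 // sqrtr_gt0.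
  rewrite -EFinM inver gt_eqF // lee_fin -[_^-1]mul1r ler_pdivlMr //; apply: ltW.
  have [_ oO cO] := hOmega; have [_ [_ _ C1p C1s]] := hu 2%N.
  apply: (equal_HR_HL_bound oO cO _ (Cn_on_C1_with (hu 1%N))
    (Cn_on_C1_with (n := 0) C1p) (Cn_on_C1_with (n := 0) C1s) hDu _ m0 _ r0 disc).
  - by [].
  - by move=> p Op; exact/hH/graphP.
  - by move=> p Op; rewrite -lee_fin Ile.
by move: I0; rewrite lee_fin leNgt m0.
Qed.
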